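(* Let $S$ be a semidomain. Then the following statements are equivalent. (a) $S$ is Furstenberg. (b) The polynomial semidomain $S[x]$ is Furstenberg. (c) The Laurent polynomial semidomain $S[x^{\pm 1}]$ is Furstenberg.
   Context: A monoid here is a commutative cancellative semigroup with identity. A semiring is a set $S$ with two operations $+$ and $\cdot$ such that $(S,+)$ is a (commutative, cancellative) monoid with identity $0$, $(S,\cdot)$ is a commutative semigroup with identity $1$, and multiplication distributes over addition. A subsemiring of a semiring (or ring) is an additive submonoid that contains $1$ and is closed under multiplication. A semidomain is a semiring that is a subsemiring of an integral domain. For a semidomain $S$, write $S^* := (S\setminus\{0\},\cdot)$, which is a monoid, called the multiplicative monoid of $S$. $S[x]$ denotes the semiring of polynomials with coefficients in $S$, and $S[x^{\pm 1}]$ the semiring of Laurent polynomials with coefficients in $S$; if $S$ is a subsemiring of an integral domain $R$, these are subsemirings of $R[x]$ and $R[x^{\pm 1}]$, and hence semidomains. For a monoid $M$ (written multiplicatively), a unit is an invertible element; $c$ divides $b$ in $M$ if $b = cd$ for some $d \in M$; an atom of $M$ is a nonunit $a \in M$ such that $a = bc$ with $b,c\in M$ implies that $b$ or $c$ is a unit. The monoid $M$ is Furstenberg if every nonunit of $M$ is divisible in $M$ by an atom of $M$. A semidomain $S$ is Furstenberg if the monoid $S^*$ is Furstenberg. *)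

(* Defs.v *)
From HB Require Import structures.
From mathcomp Require Import all_boot all_order all_algebra finmap.
From mathcomp Require Import zify.

Set Implicit Arguments.
Unset Strict Implicit.
Unset Printing Implicit Defensive.

Import GRing.Theory.

(* The library's monoidType is neither commutative nor cancellative; "monoid"
   in factorization theory means both. *)

HB.mixin Record Monoid_isComCancel M of monoid.Monoid M := {
  ccmulC : commutative (@monoid.mul M);
  ccmulI : right_injective (@monoid.mul M)
}.

#[short(type="ccMonoidType")]
HB.structure Definition CCMonoid :=
  {M of monoid.Monoid M & Monoid_isComCancel M}.

Section Divisibility.
Context (M : ccMonoidType).
Implicit Types a b c d u v : M.
Local Open Scope group_scope.

Definition invertible u : Prop := exists v, u * v = 1.

Definition divides c b : Prop := exists d, b = c * d.

Definition atom a : Prop :=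
  ~ invertible a /\ (forall b c, a = b * c -> invertible b \/ invertible c).

Definition furstenberg_monoid : Prop :=
  forall b, ~ invertible b -> exists2 a, atom a & divides a b.

End Divisibility.

Local Open Scope ring_scope.

(* A subsemiring of an integral domain, up to isomorphism. Additive
   cancellation is not a separate field: it follows from the embedding. *)
HB.mixin Record ComNzSemiRing_isSemidomain S of GRing.ComNzSemiRing S := {
  semidomain_embedding :
    exists (R : idomainType) (f : {rmorphism S -> R}), injective f
}.

#[short(type="semidomainType")]
HB.structure Definition Semidomain :=
  {S of GRing.ComNzSemiRing S & ComNzSemiRing_isSemidomain S}.

Section Nonzero.
Context (S : semidomainType).
Implicit Types x y z : S.

Lemma semidomain_addrI x : injective (+%R x).
Proof.
have [R [f f_inj]] := @semidomain_embedding S.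
by move=> y z /(congr1 f); rewrite !rmorphD => /addrI /f_inj.
Qed.

Lemma semidomain_mulf_neq0 x y : x != 0 -> y != 0 -> x * y != 0.
Proof.
have [R [f f_inj]] := @semidomain_embedding S.
rewrite -!(inj_eq f_inj) !rmorph0 rmorphM; exact: mulf_neq0.
Qed.

Lemma semidomain_mulfI x : x != 0 -> injective ( *%R x).
Proof.
have [R [f f_inj]] := @semidomain_embedding S.
rewrite -(inj_eq f_inj) rmorph0 => fx0 y z /(congr1 f).
by rewrite !rmorphM => /(mulfI fx0) /f_inj.
Qed.

(* Usually written S^*; units, atoms and divisors are taken in this monoid. *)
Definition nonzero : Type := {x : S | x != 0}.

HB.instance Definition _ := Choice.on nonzero.
HB.instance Definition _ := SubChoice.on nonzero.

Implicit Types u v w : nonzero.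

Definition nonzero_one : nonzero := Sub 1 (oner_neq0 S).

Definition nonzero_mul u v : nonzero :=
  Sub (val u * val v) (semidomain_mulf_neq0 (valP u) (valP v)).

Fact nonzero_mulA : associative nonzero_mul.
Proof. by move=> u v w; apply: val_inj; rewrite /= mulrA. Qed.

Fact nonzero_mul1 : left_id nonzero_one nonzero_mul.
Proof. by move=> u; apply: val_inj; rewrite /= mul1r. Qed.

Fact nonzero_mulC : commutative nonzero_mul.
Proof. by move=> u v; apply: val_inj; rewrite /= mulrC. Qed.

Fact nonzero_mulr1 : right_id nonzero_one nonzero_mul.
Proof. by move=> u; rewrite nonzero_mulC nonzero_mul1. Qed.

HB.instance Definition _ :=
  isMonoid.Build nonzero nonzero_mulA nonzero_mul1 nonzero_mulr1.

Fact nonzero_mulI : right_injective (@monoid.mul nonzero).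
Proof.
move=> u v w /(congr1 val) /= /(semidomain_mulfI (valP u)); exact: val_inj.
Qed.

HB.instance Definition _ :=
  Monoid_isComCancel.Build nonzero nonzero_mulC nonzero_mulI.

End Nonzero.

Definition furstenberg (S : semidomainType) : Prop :=
  furstenberg_monoid (nonzero S).

Fact poly_semidomain (S : semidomainType) :
  exists (R : idomainType) (f : {rmorphism {poly S} -> R}), injective f.
Proof.
have [R [f f_inj]] := @semidomain_embedding S.
exists {poly R}, (map_poly f); exact: map_inj_poly f_inj (rmorph0 f).
Qed.

HB.instance Definition _ (S : semidomainType) :=
  ComNzSemiRing_isSemidomain.Build {poly S} (poly_semidomain S).

(* A Laurent polynomial is the finitely supported function of its
   coefficients, indexed by the integer exponents. *)
Definition laurent (S : nzSemiRingType) : Type := {fsfun int -> S with 0}.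

Section SumSupport.
Context (S : nmodType) (I : choiceType).
Implicit Types (s t : seq I) (F : I -> S).

Lemma eq_sum_support s t F : uniq s -> uniq t ->
  (forall i, F i != 0 -> i \in s) -> (forall i, F i != 0 -> i \in t) ->
  \sum_(i <- s) F i = \sum_(i <- t) F i.
Proof.
move=> us ut Fs Ft.
have nz r : \sum_(i <- r) F i = \sum_(i <- [seq i <- r | F i != 0]) F i.
  rewrite big_filter [RHS]big_mkcond; apply: eq_bigr => i _.
  by case: eqVneq.
rewrite nz [RHS]nz; apply: perm_big; apply: uniq_perm; rewrite ?filter_uniq //.
by move=> i; rewrite !mem_filter; case: (boolP (F i != 0)) => //= Fi; rewrite Fs ?Ft.
Qed.

End SumSupport.

Section LaurentSemiRing.
Context (S : comNzSemiRingType).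

HB.instance Definition _ := Choice.on (laurent S).

Implicit Types (f g h : laurent S) (i j k : int).

Definition laurent_zero : laurent S := [fsfun].

Definition laurent_one : laurent S := [fsfun k in [fset (0 : int)%R]%fset => 1].

Definition laurent_add f g : laurent S :=
  [fsfun k in (finsupp f `|` finsupp g)%fset => f k + g k].

Definition laurent_mul f g : laurent S :=
  [fsfun k in [fset (i + j)%R | i in finsupp f, j in finsupp g]%fset =>
     \sum_(i <- finsupp f) f i * g (k - i)].

Lemma laurentP f g : (forall k, f k = g k) -> f = g.
Proof. by move=> fg; apply/fsfunP. Qed.

Lemma laurent_zeroE k : laurent_zero k = 0.
Proof. by rewrite fsfun0E. Qed.

Lemma laurent_oneE k : laurent_one k = (k == 0)%:R.
Proof. by rewrite fsfunE inE; case: eqP. Qed.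

Lemma laurent_addE f g k : laurent_add f g k = f k + g k.
Proof.
rewrite fsfunE inE; case: ifPn => //; rewrite negb_or => /andP[fk gk].
by rewrite !fsfun_dflt // addr0.
Qed.

Lemma laurent_mulE f g k :
  laurent_mul f g k = \sum_(i <- finsupp f) f i * g (k - i).
Proof.
rewrite fsfunE; case: ifPn => // kN; rewrite big_seq big1 // => i i_f.
case: (finsuppP g (k - i)) => [_|j_g]; first by rewrite mulr0.
case/negP: kN; apply/imfset2P; exists i => //; exists (k - i) => //.
by rewrite addrC subrK.
Qed.

Lemma laurent_mul_supp f g k (s : seq int) : uniq s ->
  {subset finsupp f <= s} ->
  laurent_mul f g k = \sum_(i <- s) f i * g (k - i).
Proof.
have Ff i : f i * g (k - i) != 0 -> i \in finsupp f.
  by rewrite mem_finsupp; apply: contraNneq => ->; rewrite mul0r.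
move=> us sfs; rewrite laurent_mulE; apply: eq_sum_support; rewrite ?fset_uniq //.
by move=> i /Ff /sfs.
Qed.

Fact laurent_addA : associative laurent_add.
Proof. by move=> f g h; apply: laurentP => k; rewrite !laurent_addE addrA. Qed.

Fact laurent_addC : commutative laurent_add.
Proof. by move=> f g; apply: laurentP => k; rewrite !laurent_addE addrC. Qed.

Fact laurent_add0 : left_id laurent_zero laurent_add.
Proof. by move=> f; apply: laurentP => k; rewrite laurent_addE laurent_zeroE add0r. Qed.

Fact laurent_mulC : commutative laurent_mul.
Proof.
move=> f g; apply: laurentP => k.
pose F i := g i * f (k - i).
transitivity (\sum_(i <- [seq k - i | i <- finsupp f]) F i).
  rewrite big_map laurent_mulE; apply: eq_bigr => i _.
  by rewrite /F subKr mulrC.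
have kI : injective (fun i => k - i) by move=> i j /addrI /oppr_inj.
rewrite laurent_mulE; apply: eq_sum_support; rewrite ?map_inj_uniq ?fset_uniq //.
  move=> i Fi; apply/mapP; exists (k - i); last by rewrite subKr.
  by rewrite mem_finsupp; apply: contraNneq Fi => fi; rewrite /F fi mulr0.
by move=> i Fi; rewrite mem_finsupp; apply: contraNneq Fi => gi; rewrite /F gi mul0r.
Qed.

Fact laurent_mulA : associative laurent_mul.
Proof.
move=> f g h; apply: laurentP => k.
pose B : {fset int} := [fset (i + j)%R | i in finsupp f, j in finsupp g]%fset.
rewrite [RHS](@laurent_mul_supp _ _ _ B) ?fset_uniq //; last first.
  move=> n; rewrite mem_finsupp fsfunE; case: ifP => //; by rewrite eqxx.
rewrite laurent_mulE.
under [RHS]eq_bigr do rewrite laurent_mulE mulr_suml.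
rewrite exchange_big /= big_seq [RHS]big_seq; apply: eq_bigr => i i_f.
under [RHS]eq_bigr do rewrite -mulrA.
rewrite -mulr_sumr laurent_mulE; congr (_ * _).
pose F n := g (n - i) * h (k - n).
transitivity (\sum_(n <- [seq i + j | j <- finsupp g]) F n).
  rewrite big_map; apply: eq_bigr => j _.
  by rewrite /F opprD addrA [i + j]addrC addrK.
have Fg n : F n != 0 -> n - i \in finsupp g.
  by rewrite mem_finsupp; apply: contraNneq => gn; rewrite /F gn mul0r.
apply: eq_sum_support; rewrite ?map_inj_uniq ?fset_uniq //; first exact: addrI.
  by move=> n /Fg n_g; apply/mapP; exists (n - i); rewrite // addrC subrK.
move=> n /Fg n_g; apply/imfset2P; exists i => //; exists (n - i) => //.
by rewrite addrC subrK.
Qed.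

Fact laurent_mul1 : left_id laurent_one laurent_mul.
Proof.
move=> f; apply: laurentP => k.
rewrite (@laurent_mul_supp _ _ _ [:: 0]) //; last first.
  by move=> i; rewrite mem_finsupp laurent_oneE inE; case: (i == 0); rewrite ?eqxx.
by rewrite big_seq1 laurent_oneE eqxx mul1r subr0.
Qed.

Fact laurent_mulDl : left_distributive laurent_mul laurent_add.
Proof.
move=> f g h; apply: laurentP => k; rewrite laurent_addE.
pose B := (finsupp f `|` finsupp g)%fset.
rewrite !(@laurent_mul_supp _ _ _ B) ?fset_uniq //.
- by rewrite -big_split /=; apply: eq_bigr => i _; rewrite laurent_addE mulrDl.
- by move=> i; rewrite inE orbC => ->.
- by move=> i; rewrite inE => ->.
by move=> i; rewrite mem_finsupp fsfunE; case: ifP => //; rewrite eqxx.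
Qed.

Fact laurent_mul0 : left_zero laurent_zero laurent_mul.
Proof.
move=> f; apply: laurentP => k.
by rewrite laurent_mulE big1 ?laurent_zeroE // => i _; rewrite laurent_zeroE mul0r.
Qed.

Fact laurent_1neq0 : laurent_one != laurent_zero.
Proof.
apply/eqP => /(congr1 (fun f : laurent S => f 0)).
by rewrite laurent_oneE laurent_zeroE eqxx; apply/eqP/oner_neq0.
Qed.

HB.instance Definition _ := GRing.isNmodule.Build (laurent S)
  laurent_addA laurent_addC laurent_add0.
HB.instance Definition _ :=
  GRing.Nmodule_isComNzSemiRing.Build (laurent S)
    laurent_mulA laurent_mulC laurent_mul1 laurent_mulDl laurent_mul0
    laurent_1neq0.

End LaurentSemiRing.

Section LaurentFraction.
Context (S : comNzSemiRingType) (R : idomainType) (e : {rmorphism S -> R}).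
Implicit Types (f g : laurent S) (i j k : int) (s : seq int).

Let x : {fraction {poly R}} := tofrac 'X.
Let c (a : S) : {fraction {poly R}} := tofrac (e a)%:P.

Definition laurent_frac f : {fraction {poly R}} :=
  \sum_(i <- finsupp f) c (f i) * x ^ i.

Let x_neq0 : x != 0. Proof. by rewrite tofrac_eq0 polyX_eq0. Qed.

Let c0 : c 0 = 0. Proof. by rewrite /c !rmorph0. Qed.

Let cD : {morph c : a b / a + b}.
Proof. by move=> a b; rewrite /c !rmorphD. Qed.

Let cM : {morph c : a b / a * b}.
Proof. by move=> a b; rewrite /c !rmorphM. Qed.

Lemma laurent_frac_supp f s : uniq s -> {subset finsupp f <= s} ->
  laurent_frac f = \sum_(i <- s) c (f i) * x ^ i.
Proof.
move=> us sfs; have Ff i : c (f i) * x ^ i != 0 -> i \in finsupp f.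
  by rewrite mem_finsupp; apply: contraNneq => ->; rewrite c0 mul0r.
by apply: eq_sum_support; rewrite ?fset_uniq // => i /Ff /sfs.
Qed.

Fact laurent_frac_nmod_morphism : nmod_morphism laurent_frac.
Proof.
split=> [|f g].
  by rewrite /laurent_frac big1 // => i _; rewrite laurent_zeroE c0 mul0r.
pose B := (finsupp f `|` finsupp g)%fset.
rewrite !(@laurent_frac_supp _ B) ?fset_uniq //.
- rewrite -big_split; apply: eq_bigr => i _ /=.
  by rewrite laurent_addE cD mulrDl.
- by move=> i; rewrite inE orbC => ->.
- by move=> i; rewrite inE => ->.
by move=> i; rewrite mem_finsupp fsfunE; case: ifP => //; rewrite eqxx.
Qed.

Fact laurent_frac_monoid_morphism : monoid_morphism laurent_frac.
Proof.
split=> [|f g].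
  rewrite (@laurent_frac_supp _ [:: 0]) //; last first.
    move=> i; rewrite mem_finsupp laurent_oneE inE.
    by case: (i == 0); rewrite ?eqxx.
  by rewrite big_seq1 laurent_oneE eqxx /c !rmorph1 expr0z mulr1.
pose B : {fset int} := [fset (i + j)%R | i in finsupp f, j in finsupp g]%fset.
rewrite (@laurent_frac_supp _ B) ?fset_uniq //; last first.
  by move=> n; rewrite mem_finsupp fsfunE; case: ifP => //; rewrite eqxx.
pose F i n := c (f i) * x ^ i * (c (g (n - i)) * x ^ (n - i)).
transitivity (\sum_(n <- B) \sum_(i <- finsupp f) F i n).
  apply: eq_bigr => n _; rewrite laurent_mulE.
  rewrite (big_morph c cD c0) mulr_suml; apply: eq_bigr => i _.
  by rewrite cM /F mulrACA -expfzDr // [i + _]addrC subrK.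
rewrite exchange_big /= [in RHS]/laurent_frac mulr_suml.
rewrite big_seq [RHS]big_seq; apply: eq_bigr => i i_f.
rewrite -mulr_sumr; congr (_ * _).
pose G n := c (g (n - i)) * x ^ (n - i).
transitivity (\sum_(n <- [seq i + j | j <- finsupp g]) G n); last first.
  by rewrite big_map; apply: eq_bigr => j _; rewrite /G [i + j]addrC addrK.
have Gg n : G n != 0 -> n - i \in finsupp g.
  by rewrite mem_finsupp; apply: contraNneq => gn; rewrite /G gn c0 mul0r.
apply: eq_sum_support; rewrite ?map_inj_uniq ?fset_uniq //; first exact: addrI.
  move=> n /Gg n_g; apply/imfset2P; exists i => //; exists (n - i) => //.
  by rewrite addrC subrK.
by move=> n /Gg n_g; apply/mapP; exists (n - i); rewrite // addrC subrK.
Qed.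

HB.instance Definition _ :=
  GRing.isNmodMorphism.Build (laurent S) {fraction {poly R}} laurent_frac
    laurent_frac_nmod_morphism.
HB.instance Definition _ :=
  GRing.isMonoidMorphism.Build (laurent S) {fraction {poly R}} laurent_frac
    laurent_frac_monoid_morphism.

Lemma laurent_frac_inj : injective e -> injective laurent_frac.
Proof.
move=> e_inj f g eq_fg.
pose B := (finsupp f `|` finsupp g)%fset.
pose N : nat := (\sum_(i <- B) absz i)%N.
have BN i : i \in B -> i + N%:Z = Posz (absz (i + N%:Z)).
  move=> iB; have: (absz i <= N)%N by rewrite /N (big_rem i) //= leq_addr.
  by lia.
pose P h : {poly R} := \sum_(i <- B) (e (h i))%:P * 'X^(absz (i + N%:Z)).
have fracP h : {subset finsupp h <= B} -> laurent_frac h * x ^+ N = tofrac (P h).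
  move=> hB; rewrite (@laurent_frac_supp h B) ?fset_uniq // mulr_suml.
  rewrite rmorph_sum /= big_seq [RHS]big_seq; apply: eq_bigr => i iB.
  rewrite tofracM tofracXn -mulrA; congr (_ * _).
  by rewrite -[x ^+ N]/(x ^ N%:Z) -expfzDr // BN.
have coefP h k : k \in B -> (P h)`_(absz (k + N%:Z)) = e (h k).
  move=> kB; rewrite coef_sum (bigD1_seq k) ?fset_uniq //= big_seq_cond big1.
    by rewrite coefCM coefXn eqxx mulr1 addr0.
  move=> i /andP[iB ik]; rewrite coefCM coefXn.
  case: eqP => [eq_ki|_]; last by rewrite mulr0.
  case/eqP: ik; apply: (@addIr _ N%:Z).
  by rewrite BN // [RHS]BN // eq_ki.
have fB : {subset finsupp f <= B} by move=> i; rewrite inE => ->.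
have gB : {subset finsupp g <= B} by move=> i; rewrite inE orbC => ->.
have eq_P : P f = P g by apply/eqP; rewrite -tofrac_eq -!fracP // eq_fg.
apply: laurentP => k; have [kB|kNB] := boolP (k \in B).
  by apply: e_inj; rewrite -!coefP // eq_P.
by rewrite !fsfun_dflt //; [apply: contra kNB => /gB | apply: contra kNB => /fB].
Qed.

End LaurentFraction.

Fact laurent_semidomain (S : semidomainType) :
  exists (R : idomainType) (f : {rmorphism laurent S -> R}), injective f.
Proof.
have [R [e e_inj]] := @semidomain_embedding S.
exists {fraction {poly R}}, (laurent_frac e); exact: laurent_frac_inj.
Qed.

HB.instance Definition _ (S : semidomainType) :=
  ComNzSemiRing_isSemidomain.Build (laurent S) (laurent_semidomain S).

(* Main.v *)
Require Import Defs.
From HB Require Import structures.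
From mathcomp Require Import all_boot all_order all_algebra finmap.
From mathcomp Require Import zify.
From Stdlib Require Import Classical.

(** Degrees add up in [S[x]], so a factorization of a nonconstant polynomial
    either splits off a nonunit constant, which has an atomic divisor in [S],
    or strictly lowers the degree; this gives (a) => (b).  Every nonzero Laurent
    polynomial is uniquely [x^k p] with [p] a polynomial such that [p(0) <> 0],
    and such products multiply componentwise.  Hence units, atoms and divisors
    in [S[x^±1]] are those of the polynomials with nonzero constant term, a class
    closed under divisors, which gives (b) => (c).  Finally the divisors of a
    constant in that class are constants, which gives (c) => (a). *)

Set Implicit Arguments.
Unset Strict Implicit.
Unset Printing Implicit Defensive.

Import Order.TTheory GRing.Theory Num.Theory.

Local Open Scope ring_scope.

(** * Units and atoms without the subtype of nonzero elements *)

Section Elements.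
Context (S : semidomainType).
Implicit Types a b c d x y z : S.

Definition sunit x : Prop := exists y, x * y = 1.

Definition satom a : Prop :=
  [/\ a != 0, ~ sunit a & forall b c, a = b * c -> sunit b \/ sunit c].

Lemma invertibleE (u : nonzero S) : invertible u <-> sunit (val u).
Proof.
split=> [[v /(congr1 val) /= uv]|[y uy]]; first by exists (val v).
have y0 : y != 0.
  by apply: contra_eq_neq uy => ->; rewrite mulr0 eq_sym oner_neq0.
by exists (Sub y y0 : nonzero S); exact/val_inj.
Qed.

Lemma mul_neq0_factors x y : x * y != 0 -> x != 0 /\ y != 0.
Proof.
by move=> xy0; split; apply: contraNneq xy0 => ->; rewrite ?mul0r ?mulr0.
Qed.

(** A nonzero product has nonzero factors, so every factorization of [val u] in [S] already takes
    place in [nonzero S]. *)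
Lemma atomE (u : nonzero S) : atom u <-> satom (val u).
Proof.
split=> [[uN uA]|[_ uN uA]].
  split; [exact: (valP u) | by move/invertibleE|move=> b c ubc].
  have /mul_neq0_factors[b0 c0] : b * c != 0 by rewrite -ubc (valP u).
  have /uA : u = monoid.mul (Sub b b0 : nonzero S) (Sub c c0 : nonzero S).
    exact/val_inj.
  by case=> /invertibleE; [left | right].
split=> [/invertibleE //|v w /(congr1 val) /= /uA].
by case=> /invertibleE; [left | right].
Qed.

Lemma furstenbergE : furstenberg S <->
  forall b, b != 0 -> ~ sunit b -> exists a d, satom a /\ b = a * d.
Proof.
split=> [FS b b0 bN|FS u uN].
  have [|a /atomE aA [d /(congr1 val) /= bad]] := FS (Sub b b0).
    by move/invertibleE.
  by exists (val a), (val d).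
have [|a [d [aA uad]]] := FS (val u) (valP u); first by move/invertibleE.
have /mul_neq0_factors[a0 d0] : a * d != 0 by rewrite -uad (valP u).
by exists (Sub a a0); [apply/atomE | exists (Sub d d0 : nonzero S); exact/val_inj].
Qed.

End Elements.

(** * Degrees, constants and the passage to polynomials *)

Section Polynomials.
Context (S : semidomainType).
Implicit Types (a b c : S) (p q : {poly S}).

(** The embedding into an integral domain, applied coefficientwise, preserves sizes, and there sizes
    are additive up to one. *)
Lemma size_semidomain_mul p q : p != 0 -> q != 0 ->
  size (p * q) = (size p + size q).-1.
Proof.
have [R [f f_inj]] := @semidomain_embedding S.
have fpI := map_inj_poly f_inj (rmorph0 f).
rewrite -2!(inj_eq fpI) !rmorph0 => p0 q0.
by rewrite -!(size_map_inj_poly f_inj (rmorph0 f)) rmorphM size_mul.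
Qed.

Lemma mul_eq_polyC c p q : c != 0 -> c%:P = p * q ->
  exists a b, [/\ p = a%:P, q = b%:P & c = a * b].
Proof.
move=> c0 cpq.
have /mul_neq0_factors[p0 q0] : p * q != 0 by rewrite -cpq polyC_eq0.
move: p0 q0 (size_semidomain_mul p0 q0).
rewrite -cpq size_polyC c0 -!size_poly_gt0 => p0 q0 sz.
have /size1_polyC pE : (size p <= 1)%N by lia.
have /size1_polyC qE : (size q <= 1)%N by lia.
exists p`_0, q`_0; split=> //; apply: polyC_inj.
by rewrite polyCM -pE -qE.
Qed.

Lemma sunit_polyC c : sunit c%:P <-> sunit c.
Proof.
split=> [[p cp]|[b cb]]; last by exists b%:P; rewrite -polyCM cb.
have [a [b [/polyC_inj ca _ ab]]] := mul_eq_polyC (oner_neq0 S) (esym cp).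
by exists b; rewrite ca -ab.
Qed.

Lemma satom_polyC c : satom c -> satom c%:P.
Proof.
case=> c0 cN cA; split; first by rewrite polyC_eq0.
  by move/sunit_polyC.
move=> p q /(mul_eq_polyC c0)[a [b [-> -> /cA]]].
by case=> /sunit_polyC; [left | right].
Qed.

Lemma coef0_mul p q : (p * q)`_0 = p`_0 * q`_0.
Proof. by rewrite coefM big_ord1. Qed.

Lemma furstenberg_poly : furstenberg S -> furstenberg {poly S}.
Proof.
move=> /furstenbergE FS; apply/furstenbergE => p.
have [n] := ubnP (size p); elim: n p => // n IHn p p_n p0 pN.
(* Nonunit constants take their atomic divisor from [S]. *)
have FC q : (size q <= 1)%N -> q != 0 -> ~ sunit q ->
    exists a d : {poly S}, satom a /\ q = a * d.
  move=> /size1_polyC ->; rewrite polyC_eq0 => q0 qN.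
  have [|a [d [aA qad]]] := FS _ q0; first by move/sunit_polyC.
  by exists a%:P, d%:P; rewrite -polyCM -qad; split=> //; apply: satom_polyC.
have [pA|pNA] := classic (satom p); first by exists p, 1; rewrite mulr1.
have [q [r [pqr qN rN]]] : exists q r, [/\ p = q * r, ~ sunit q & ~ sunit r].
  apply: NNPP => nE; apply: pNA; split=> // q r pqr.
  by apply: NNPP => /not_or_and[qN rN]; apply: nE; exists q, r.
have /mul_neq0_factors[q0 r0] : q * r != 0 by rewrite -pqr.
have := size_semidomain_mul q0 r0; rewrite -pqr => sz.
have [q1|q_gt1] := leqP (size q) 1.
  have [a [d [aA qad]]] := FC q q1 q0 qN.
  by exists a, (d * r); split=> //; rewrite mulrA -qad.
(* As [q] is nonconstant, [r] is strictly smaller than [p]. *)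
have [a [d [aA rad]]] : exists a d : {poly S}, satom a /\ r = a * d.
  by apply: IHn => //; lia.
by exists a, (q * d); split=> //; rewrite pqr rad mulrCA.
Qed.

End Polynomials.

(** * Normal form of Laurent polynomials *)

Section LaurentShift.
Context (S : semidomainType).
Implicit Types (p q r : {poly S}) (f g : laurent S) (k l n : int).

(* The Laurent polynomial [x^k p]. *)
Definition shift k p : laurent S :=
  [fsfun n in [fset (k + Posz i)%R | i in iota 0 (size p)]%fset =>
     p`_(absz (n - k))].

Lemma shiftE k p n : shift k p n = if k <= n then p`_(absz (n - k)) else 0.
Proof.
rewrite fsfunE; case: ifPn => [/imfsetP[i _ ->]|nN].
  by have -> : k <= k + Posz i by lia.
case: ifP => // kn; rewrite nth_default // leqNgt.
apply: contra nN => ni; apply/imfsetP; exists (absz (n - k)); last by lia.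
by rewrite /= mem_iota.
Qed.

Lemma shift_mul k l p q : shift k p * shift l q = shift (k + l) (p * q).
Proof.
apply: laurentP => n.
rewrite -[_ * _]/(laurent_mul _ _).
pose F (i : nat) := p`_i * shift l q (n - (k + Posz i)).
transitivity (\sum_(i <- iota 0 (size p)) F i).
  rewrite (@laurent_mul_supp _ _ _ _ [seq k + Posz i | i <- iota 0 (size p)]).
  - rewrite big_map; apply: eq_bigr => i _; rewrite shiftE /F.
    have -> : k <= k + Posz i by lia.
    by congr (p`_ _ * _); lia.
  - by rewrite map_inj_uniq ?iota_uniq // => i j; lia.
  move=> i; rewrite mem_finsupp fsfunE; case: ifP; last by rewrite eqxx.
  by move=> /imfsetP[j /= jp ->] _; apply: map_f.
rewrite shiftE; case: ifPn => kln; last first.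
  rewrite big1 // => i _; rewrite /F shiftE.
  by case: ifP => [|_]; [lia | rewrite mulr0].
rewrite coefM.
(* Both ranges contain the support of [F]: a term vanishes for [i] at least [size p], and also when
   [n - (k + i)] falls below [l]. *)
transitivity (\sum_(i <- iota 0 (absz (n - (k + l))%R).+1) F i).
  apply: eq_sum_support; rewrite ?iota_uniq // => i; rewrite mem_iota /F.
    rewrite leq0n add0n ltnNge; apply: contra_neqN => ?.
    by rewrite nth_default ?mul0r.
  by rewrite shiftE; case: ifP => [|_]; [lia | rewrite mulr0 eqxx].
rewrite -[X in iota 0 X]subn0 -/(index_iota 0 _) big_mkord.
apply: eq_bigr => -[i im] _ /=; rewrite /F shiftE.
case: ifP => [_|]; last by lia.
by congr (_ * q`_ _); lia.
Qed.

Lemma shift_1 : shift 0 1 = 1.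
Proof.
apply: laurentP => n; rewrite shiftE [RHS]laurent_oneE coef1.
by case: ifP => n0; [congr (nat_of_bool _)%:R; lia | case: eqP => // ?; lia].
Qed.

Lemma shift_surj f : f != 0 -> exists k p, p`_0 != 0 /\ f = shift k p.
Proof.
move=> f0; pose N : nat := (\sum_(i <- finsupp f) absz i)%N.
have fN i : f i != 0 -> (`|i| <= N)%N.
  by rewrite -mem_finsupp => iF; rewrite /N (big_rem i) //= leq_addr.
(* All exponents of [f] are at least [-N], so adding [N] makes them naturals and a least one
   exists. *)
have exm : exists m : nat, f (Posz m - Posz N) != 0.
  apply: NNPP => nE; case/eqP: f0; apply: laurentP => n.
  rewrite [RHS]laurent_zeroE; apply/eqP; apply: contraT => fn.
  case: nE; exists (absz (n + Posz N)).
  by have nN := fN _ fn; have -> : Posz (absz (n + Posz N)) - Posz N = n by lia.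
case: (ex_minnP exm) => m fm m_min.
pose k : int := Posz m - Posz N.
(* The exponents of [f] lie between [k] and [N], and [-N <= k], so [2N + 1] coefficients suffice. *)
exists k, (\poly_(i < (N + N).+1) f (k + Posz i)).
split; first by rewrite coef_poly /= addr0.
apply: laurentP => n; rewrite shiftE coef_poly.
case: ifPn => kn.
  have kE : k + Posz (absz (n - k)) = n by lia.
  rewrite kE; case: ifPn => // nbig; apply/eqP; apply: contraT => /fN; lia.
apply/eqP; apply: contraT => fn.
have nN := fN _ fn; have := m_min (absz (n + Posz N)).
have -> : Posz (absz (n + Posz N)) - Posz N = n by lia.
by move/(_ fn); lia.
Qed.

Lemma shift_inj k l p q : p`_0 != 0 -> q`_0 != 0 -> shift k p = shift l q ->
  k = l /\ p = q.
Proof.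
(* At exponent [i] the left side is nonzero, while the right side vanishes below [j]. *)
have le i j (u v : {poly S}) : u`_0 != 0 -> shift i u = shift j v -> j <= i.
  move=> u0 /(congr1 (fun f : laurent S => f i)); rewrite !shiftE lexx subrr.
  by case: ifP => // _ /eqP; rewrite (negPf u0).
move=> p0 q0 E; have kl : k = l.
  by apply/eqP; rewrite eq_le (le _ _ _ _ p0 E) (le _ _ _ _ q0 (esym E)).
split=> //; apply/polyP => i.
move/(congr1 (fun f : laurent S => f (k + Posz i))): E; rewrite !shiftE -kl.
have -> : k <= k + Posz i by lia.
by have -> : absz (k + Posz i - k)%R = i by lia.
Qed.

Lemma shift_neq0 k p : p`_0 != 0 -> shift k p != 0.
Proof.
apply: contraNneq => /(congr1 (fun f : laurent S => f k)).
by rewrite shiftE lexx subrr [RHS]laurent_zeroE => ->.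
Qed.

(** The normal forms of [f] and [g] multiply to a normal form, since the product of their constant
    terms is nonzero; uniqueness then gives [p = q * r]. *)
Lemma shift_eq_mul k p f g : p`_0 != 0 -> shift k p = f * g ->
  exists i j q r, [/\ q`_0 != 0, r`_0 != 0, f = shift i q, g = shift j r
    & p = q * r].
Proof.
move=> p0 pfg.
have /mul_neq0_factors[f0 g0] : f * g != 0 by rewrite -pfg shift_neq0.
have [i [q [q0 fE]]] := shift_surj f0; have [j [r [r0 gE]]] := shift_surj g0.
exists i, j, q, r; split=> //.
move: pfg; rewrite fE gE shift_mul => /shift_inj[] //.
by rewrite coef0_mul semidomain_mulf_neq0.
Qed.

Lemma coef0_poly1_neq0 : (1 : {poly S})`_0 != 0.
Proof. by rewrite coef1 oner_neq0. Qed.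

Lemma sunit_shift k p : p`_0 != 0 -> sunit (shift k p) <-> sunit p.
Proof.
move=> p0; split=> [[f]|[q pq]]; last first.
  by exists (shift (- k) q); rewrite shift_mul subrr pq shift_1.
(* The element [1] has normal form [shift 0 1], so its factors have polynomial parts with product
   [1]. *)
rewrite -shift_1 => /esym /(shift_eq_mul coef0_poly1_neq0).
case=> [i [j [q [r [q0 r0 /(shift_inj p0 q0)[_ ->] _ qr]]]]].
by exists r.
Qed.

Lemma satom_shift k p : p`_0 != 0 -> satom (shift k p) <-> satom p.
Proof.
move=> p0; split=> [[_ pN pA]|[_ pN pA]].
  split; first by apply: contraNneq p0 => ->; rewrite coef0.
    by move/(sunit_shift k p0).
  move=> q r pqr; have := p0; rewrite pqr coef0_mul => /mul_neq0_factors[q0 r0].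
  (* The monomial [x^k] is carried by the first factor. *)
  have /pA : shift k p = shift k q * shift 0 r by rewrite shift_mul addr0 -pqr.
  by case=> /sunit_shift; [left | right]; auto.
split; [exact: shift_neq0 | by move/sunit_shift; auto | move=> f g].
case/(shift_eq_mul p0)=> [i [j [q [r [q0 r0 -> -> /pA]]]]].
by case=> [qU|rU]; [left | right]; apply/sunit_shift.
Qed.

Lemma furstenberg_laurent : furstenberg {poly S} -> furstenberg (laurent S).
Proof.
move=> /furstenbergE FP; apply/furstenbergE => f /shift_surj[k [p [p0 ->]]].
move=> /(sunit_shift k p0) pN.
have [|a [d [aA pad]]] := FP p _ pN.
  by apply: contraNneq p0 => ->; rewrite coef0.
have := p0; rewrite pad coef0_mul => /mul_neq0_factors[a0 _].
(* The atom stays at exponent 0 and the cofactor absorbs [x^k]. *)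
exists (shift 0 a), (shift k d); rewrite shift_mul add0r; split=> //.
exact/satom_shift.
Qed.

Lemma furstenberg_coef : furstenberg (laurent S) -> furstenberg S.
Proof.
move=> /furstenbergE FL; apply/furstenbergE => c c0 cN.
have cP0 : c%:P`_0 != 0 by rewrite coefC.
have [||f [g [fA]]] := FL (shift 0 c%:P); first exact: shift_neq0.
  by move=> /(sunit_shift 0 cP0) /sunit_polyC.
(* The polynomial part [q] of the atom divides the constant [c], so it is itself a constant [a]. *)
case/(shift_eq_mul cP0)=> [i [j [q [r [q0 r0 fE _]]]]].
case/(mul_eq_polyC c0)=> [a [b [qE _ cab]]].
exists a, b; split=> //.
move: fA; rewrite fE => /(satom_shift _ q0); rewrite qE => -[a0 aN aA].
split; [by rewrite -polyC_eq0 | by move/sunit_polyC | move=> x y axy].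
have [] := aA x%:P y%:P; first by rewrite -polyCM -axy.
  by move/sunit_polyC; left.
by move/sunit_polyC; right.
Qed.

End LaurentShift.

Theorem theorem3p2 (S : semidomainType) :
  [<-> furstenberg S;
       furstenberg {poly S};
       furstenberg (laurent S)].
Proof.
tfae.
- exact: furstenberg_poly.
- exact: furstenberg_laurent.
- exact: furstenberg_coef.
Qed.
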